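(* For all integers $m,n\ge0$, the number of $K$-paths from $(0,-2m)$ to $(2n,0)$ is equal to the number of $T$-paths from $(0,-2m)$ to $(2n,0)$, which is $T(2n,2m)$. Moreover, for all $n\ge 0$, $$U_n=\det\bigl(T(2i,2j)\bigr)_{0\le i,j\le n-1}.$$
   Context: $U_n=\det(a_{i+j})_{0\le i,j\le n-1}$ with $a_k=\frac1{2k+1}\binom{3k}{k}$; $0\times 0$ determinants are $1$. Paths are finite sequences of points (vertices) of $\mathbb Z^2$; steps are differences of consecutive vertices. A normal path has steps $(1,0),(0,1)$; an $H_2$-path has steps $(2,0),(0,1)$; a $V_2$-path has steps $(1,0),(0,2)$; a $T$-path has steps $(2,0),(1,1),(0,2)$. The trinomial coefficient is $T(a,b)=[x^ay^b](x^2+xy+y^2)^{(a+b)/2}$ if $a+b$ is even, and $T(a,b)=0$ otherwise. A $K$-path is a path $P$ such that: (1) $P$ never goes above the diagonal (all vertices satisfy $y\le x$); (2) the part of $P$ below the line $y=-2x$ is a $V_2$-path; (3) the part of $P$ between the lines $y=-2x$ and $x=-2y$ is a normal path; (4) the part of $P$ above the line $x=-2y$ is an $H_2$-path. Thus $P$ is a $V_2$-path followed by a normal path followed by an $H_2$-path (some possibly empty), consecutive parts meeting at a vertex on the separating line. Precisely, all vertices satisfy $y\le x$, and each step from a vertex $(x,y)$ satisfies: if $y<-2x$, the step is $(1,0)$ or $(0,2)$ and its endpoint $(x',y')$ has $y'\le -2x'$; if $y\ge -2x$ and $x<-2y$, the step is $(1,0)$ or $(0,1)$ and its endpoint has $x'\le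 -2y'$; if $x\ge -2y$, the step is $(2,0)$ or $(0,1)$. *)

(* Defs.v *)
From mathcomp Require Import all_boot all_order all_algebra.
From mathcomp Require Import classical_sets functions cardinality.
Set Implicit Arguments. Unset Strict Implicit. Unset Printing Implicit Defensive.
Import Order.TTheory GRing.Theory Num.Theory.
Local Open Scope ring_scope.

Definition vertex : Type := (int * int)%type.

Definition normal_steps : seq vertex := [:: (1, 0); (0, 1)].
Definition H2_steps : seq vertex := [:: (2, 0); (0, 1)].
Definition V2_steps : seq vertex := [:: (1, 0); (0, 2)].
Definition T_steps : seq vertex := [:: (2, 0); (1, 1); (0, 2)].

(* A path is its sequence of vertices.  The empty sequence passes T_path and
   K_path, but [joins] only holds of nonempty sequences. *)
Definition joins (u v : vertex) (p : seq vertex) : bool :=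
  (ohead p == Some u) && (last u p == v).

Definition T_path (p : seq vertex) : bool :=
  sorted (fun u v : vertex => v - u \in T_steps) p.

Definition K_step (u v : vertex) : bool :=
  if u.2 < - 2 * u.1 then (v - u \in V2_steps) && (v.2 <= - 2 * v.1)
  else if u.1 < - 2 * u.2 then (v - u \in normal_steps) && (v.1 <= - 2 * v.2)
  else v - u \in H2_steps.

Definition K_path (p : seq vertex) : bool :=
  all (fun v : vertex => v.2 <= v.1) p && sorted K_step p.

Definition K_paths (u v : vertex) : set (seq vertex) :=
  [set p | K_path p /\ joins u v p]%classic.

Definition T_paths (u v : vertex) : set (seq vertex) :=
  [set p | T_path p /\ joins u v p]%classic.

(* Bivariate polynomials are {poly {poly nat}}: x is the outer variable 'X and
   y the inner one 'X%:P, so the coefficient of x^a y^b in q is q`_a`_b. *)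
Definition trinomial (a b : nat) : nat :=
  if odd (a + b) then 0%N
  else (('X ^+ 2 + 'X * 'X%:P + 'X%:P ^+ 2 : {poly {poly nat}})
          ^+ (a + b)./2)`_a`_b.

Definition acoef (k : nat) : rat := (2 * k + 1)%:R^-1 * 'C(3 * k, k)%:R.

Definition U (n : nat) : rat :=
  \det (\matrix_(i < n, j < n) acoef (i + j)).

(* Main.v *)
From HB Require Import structures.
Require Import Defs.
From mathcomp Require Import all_boot all_order all_algebra.
From mathcomp Require Import classical_sets functions cardinality.
From mathcomp Require Import finmap zify ring.
Set Implicit Arguments. Unset Strict Implicit. Unset Printing Implicit Defensive.
Import Order.TTheory GRing.Theory Num.Theory.
Local Open Scope ring_scope.

(** Everything goes through the number G(i, j) = binom(i + j, 2 i - j) of normal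
    paths from (i, -2 i) to (2 j, -j), which is [crossing i j] below.

    Paths.  Steps only go right or up, so a K-path from (0, -2 m) to (2 n, 0)
    stays in the quadrant y <= 0 <= x, meets the line y = -2 x in one point
    (i, -2 i) and the line x = -2 y in one point (2 j, -j).  Its three parts can be
    chosen independently, in binom(m, i), G(i, j) and binom(n, j) ways.  Hence
    there are sum_(i, j) binom(m, i) binom(n, j) G(i, j) of them.  Now G(i, j) is
    the constant term of alpha^i beta^j, where alpha = (1 + z) / z^2 and
    beta = z (1 + z).  The binomial theorem turns the double sum into the constant
    term of (1 + alpha)^m (1 + beta)^n = (1 + z + z^2)^(m + n) / z^(2 m), which is
    T(2 n, 2 m) ([trinomial_crossing]).  T-paths are counted by the coefficient
    recurrence of (x^2 + x y + y^2)^N.  Both counts are obtained by checking that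
    the closed formula satisfies the first-step recurrence ([card_paths]).

    Determinant.  The formula just found says that the matrix T(2 i, 2 j) is
    C G C^T with C = (binom(i, k)) lower unitriangular, so T and G have the same
    determinant.  It remains to see that G is congruent in the same way to the
    Hankel matrix of the a_k.  Let [moment] be the linear functional sending x^k to
    a_k.  There are monic polynomials q_k of degree k ([hankel_basis]) with
    moment (q_k q_l) = G(k, l) ([moment_crossing]).  They have generating function
      sum_k q_k(x) t^k = (1 + t)^2 / ((1 + t)^3 - x t),
    so multiplication by x acts on them as a shift operator, [shift3], which away
    from the boundary is s(k+1) + 3 s(k) + 3 s(k-1) + s(k-2).  A bilinear form
    (f, g) |-> moment (f g) is characterized by its values moment (1 q_l) and by
    the fact that multiplication by x may be moved from one argument to the other.
    For G the second property holds because (1 + alpha)^3 / alpha^2 and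
    (1 + beta)^3 / beta^2 are the same rational function of z
    ([crossing_shift], [crossing_shift3]); for the first one, moment q_l is, up to
    a factor, an l-th finite difference of a polynomial of degree l - 1, hence
    vanishes for l > 0 ([moment_hankel_basis]). *)

(** * Counting paths by a recurrence *)

Lemma card_eq_uniq_seq (T : choiceType) (s : seq T) :
  uniq s -> ([set` s] #= `I_(size s))%card.
Proof.
move=> us; suff -> : [set` s]%classic = [set` [fset x in s]%fset]%classic.
  by apply/card_eq_fsetP; rewrite card_fseq undup_id.
by apply/seteqP; split=> x /=; rewrite in_fset.
Qed.

Lemma joins_cons (u v x : vertex) p :
  joins u v (x :: p) = (x == u) && (last x p == v).
Proof. by []. Qed.

Section PathCount.
Variables (e : rel vertex) (cand : vertex -> seq vertex) (v : vertex).

(** The argument [d] bounds the number of vertices; it only makes the recursion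
    structural, since [mu] below bounds the length of the paths that occur. *)
Fixpoint walks (d : nat) (u : vertex) : seq (seq vertex) :=
  if d is d'.+1 then
    nseq (u == v) [:: u] ++
    [seq u :: p | w <- [seq w <- cand u | e u w], p <- walks d' w]
  else [::].

Hypothesis cand_uniq : forall u, uniq (cand u).
Hypothesis cand_step : forall u w, e u w -> w \in cand u.

Lemma mem_walks d u p :
  (p \in walks d u) = [&& sorted e p, joins u v p & (size p <= d)%N].
Proof.
elim: d u p => [|d IHd] u p; first by case: p => [|x p]; rewrite ?andbF.
rewrite mem_cat mem_nseq; apply/orP/and3P => [[/andP[uv /eqP->]|]|[]].
- by split=> //; rewrite joins_cons eqxx /=; case: (u == v) uv.
- move=> /allpairsPdep[w [q [+ + ->]]].
  rewrite mem_filter IHd => /andP[euw _] /and3P[sq /andP[hq /= lq] zq].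
  case: q => // x q in sq hq lq zq *; move: hq lq => /eqP[xw] /= lq; subst x.
  by split=> //=; rewrite ?euw ?sq // joins_cons eqxx /= lq.
case: p => // x [|y p] /= sp /andP[/eqP[xu] /= lp] zp; subst x.
  by left; rewrite lp eqxx.
right; apply/allpairsPdep; exists y, (y :: p); have /andP[euy py] := sp.
split=> //; first by rewrite mem_filter euy cand_step.
by rewrite IHd joins_cons /= py eqxx (eqP lp) eqxx.
Qed.

Lemma walks_uniq d u : uniq (walks d u).
Proof.
elim: d u => //= d IHd u; rewrite cat_uniq.
have hd w p : p \in walks d w -> ohead p = Some w.
  by rewrite mem_walks => /and3P[_ /andP[/eqP]].
apply/and3P; split; first by case: (u == v).
  apply/hasPn => _ /allpairsPdep[w [p [_ /hd pw ->]]].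
  by rewrite mem_nseq; case: p pw => // x p _; rewrite eqseq_cons andbF andbF.
apply: allpairs_uniq_dep => [|w _|? ?]; rewrite ?filter_uniq ?IHd //.
move=> /allpairsPdep[w1 [p1 [_ /hd h1 ->]]] /allpairsPdep[w2 [p2 [_ /hd h2 ->]]].
by move=> /= [p12]; subst p2; move: h1; rewrite h2 => -[->].
Qed.

(* The potential [mu] decreases along steps.  The predicate [inv] is an invariant
   of the vertices reached, so that [c] need only be correct on these. *)
Variables (inv : pred vertex) (mu : vertex -> int) (c : vertex -> nat).
Hypothesis inv_step : forall u w, inv u -> e u w -> inv w && (mu w < mu u).
Hypothesis mu_lt0 : forall u, inv u -> mu u < 0 -> c u = 0%N.
Hypothesis c_rec : forall u, inv u ->
  c u = ((u == v) + \sum_(w <- cand u | e u w) c w)%N.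

Lemma size_walks d u : inv u -> mu u < d%:Z -> size (walks d u) = c u.
Proof.
elim: d u => [|d IHd] u iu mud /=; first by rewrite mu_lt0.
rewrite c_rec // size_cat size_nseq size_allpairs_dep sumnE big_map; congr addn.
rewrite big_filter big_seq_cond [RHS]big_seq_cond; apply: eq_bigr => w /andP[_ euw].
by have /andP[iw muw] := inv_step iu euw; apply: IHd => //; lia.
Qed.

Lemma path_size u p : inv u -> sorted e p -> joins u v p ->
  (size p)%:Z <= mu u - mu v + 1.
Proof.
case: p => // x p iu /= + /andP[/eqP[xu] /eqP lp]; subst x.
elim: p u iu lp => [|w p IHp] u iu /= lp; first by rewrite -lp => _; lia.
move=> /andP[euw pw]; have /andP[iw muw] := inv_step iu euw.
have /= := IHp w iw lp pw; lia.
Qed.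

(** First-step analysis: a function that satisfies the recurrence of the number of
    paths to [v] is that number, because the recurrence is well founded. *)
Lemma card_paths u : inv u ->
  ([set p | sorted e p /\ joins u v p]%classic #= `I_(c u))%card.
Proof.
move=> iu; pose d := (`|mu u| + `|mu u - mu v| + 1)%N.
have <- : size (walks d u) = c u by apply: size_walks => //; rewrite /d; lia.
suff -> : [set p | sorted e p /\ joins u v p]%classic = [set` walks d u]%classic.
  exact/card_eq_uniq_seq/walks_uniq.
apply/seteqP; split=> p /=; rewrite mem_walks.
  move=> [sp jp]; rewrite sp jp /=.
  have := path_size iu sp jp; rewrite /d.
  move: (size p) (mu u) (mu v) => a b c'; lia.
by move=> /and3P[].
Qed.
End PathCount.

(** * Trinomial and binomial coefficients *)

(** Counts the normal paths with [p] right steps and [q] up steps.  Integer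
    arguments, with value 0 on negative ones, make Pascal's rule hold everywhere
    but at the origin. *)
Definition nb_normal (p q : int) : nat :=
  if (0 <= p) && (0 <= q) then 'C(absz (p + q), absz q) else 0%N.

Lemma nb_normal_nat (a b : nat) : nb_normal a b = 'C(a + b, b).
Proof. by []. Qed.

Lemma nb_normal_out (p q : int) : (p < 0) || (q < 0) -> nb_normal p q = 0%N.
Proof. by rewrite /nb_normal; case: ifP => //; lia. Qed.

Lemma nb_normal_rec (p q : int) :
  nb_normal p q =
    (((p == 0) && (q == 0)) + nb_normal (p - 1) q + nb_normal p (q - 1))%N.
Proof.
have [|] := boolP ((p < 0) || (q < 0)).
  move=> out; have -> : (p == 0) && (q == 0) = false by lia.
  by rewrite !nb_normal_out //; lia.
rewrite negb_or -!leNgt; case: p => // a; case: q => // b _.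
have predZ n : n.+1%:Z - 1 = n by lia.
case: a => [|a]; case: b => [|b]; rewrite ?predZ.
- by rewrite !(@nb_normal_out _ (_ - _)) ?(@nb_normal_out (_ - _)).
- by rewrite (@nb_normal_out (_ - _)) // !nb_normal_nat !binn.
- by rewrite (@nb_normal_out _ (_ - _)) // !nb_normal_nat !bin0.
- by rewrite !nb_normal_nat addSn binS addSnnS.
Qed.

Definition crossing (i j : nat) : nat := nb_normal (2 * j%:Z - i%:Z) (2 * i%:Z - j%:Z).

Lemma crossingC i j : crossing i j = crossing j i.
Proof.
rewrite /crossing /nb_normal andbC; case: ifP => // /andP[h1 h2].
by rewrite -bin_sub; [congr ('C(_, _)); lia | lia].
Qed.

Lemma coef_1addXn n k : ((1 + 'X : {poly nat}) ^+ n)`_k = 'C(n, k).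
Proof.
elim: n k => [|n IHn] [|k]; rewrite ?expr0 ?coef1 ?bin0 //.
  by rewrite exprS mulrDl mul1r coefD coefXM /= IHn bin0.
by rewrite exprS mulrDl mul1r coefD coefXM /= !IHn binS.
Qed.

(** G(i, j) is the constant term of alpha^i beta^j, where alpha = (1 + z) / z^2 and
    beta = z (1 + z).  Multiplying by z^(2 N) with [N >= i] clears the
    denominator. *)
Lemma crossing_coef (N i j : nat) : (i <= N)%N ->
  crossing i j = ((1 + 'X : {poly nat}) ^+ (i + j) * 'X^(2 * (N - i) + j))`_(2 * N).
Proof.
move=> iN; rewrite coefMXn; case: ltnP => h.
  by rewrite /crossing nb_normal_out //; lia.
rewrite coef_1addXn /crossing /nb_normal; case: ifP => h'.
  by congr ('C(_, _)); lia.
by rewrite bin_small //; lia.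
Qed.

(** Since alpha + 3 + 3 / alpha + 1 / alpha^2 = beta + 3 + 3 / beta + 1 / beta^2,
    multiplying alpha^k beta^l by this common value amounts to a shift in [k] as
    well as to the same shift in [l].  The terms equal on both sides are left
    out. *)
Lemma crossing_shift i j :
  (crossing i.+3 j.+2 + 3 * crossing i.+1 j.+2 + crossing i j.+2 =
   crossing i.+2 j.+3 + 3 * crossing i.+2 j.+1 + crossing i.+2 j)%N.
Proof.
rewrite !(@crossing_coef i.+3); try lia.
have -> : (i.+3 - i.+3 = 0)%N by lia.
have -> : (i.+3 - i.+2 = 1)%N by lia.
have -> : (i.+3 - i.+1 = 2)%N by lia.
have -> : (i.+3 - i = 3)%N by lia.
set f := fun p : {poly nat} => p`_(2 * i.+3).
rewrite -!/(f _).
have fD p q : (f p + f q)%N = f (p + q) by rewrite /f coefD.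
have f3 p : (3 * f p)%N = f (p *+ 3) by rewrite /f coefMn; lia.
rewrite !f3 !fD; congr f.
(* Offsets from j and i + j + 2 in the exponents, to abstract the common factor
   z^j (1 + z)^(i + j + 2). *)
rewrite (_ : i.+3 + j.+2 = i + j.+2 + 3)%N; last lia.
rewrite (_ : i.+1 + j.+2 = i + j.+2 + 1)%N; last lia.
rewrite (_ : i.+2 + j.+3 = i + j.+2 + 3)%N; last lia.
rewrite (_ : i.+2 + j.+1 = i + j.+2 + 1)%N; last lia.
rewrite (_ : i.+2 + j = i + j.+2)%N; last lia.
rewrite (_ : 2 * 0 + j.+2 = j + 2)%N; last lia.
rewrite (_ : 2 * 2 + j.+2 = j + 6)%N; last lia.
rewrite (_ : 2 * 3 + j.+2 = j + 8)%N; last lia.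
rewrite (_ : 2 * 1 + j.+3 = j + 5)%N; last lia.
rewrite (_ : 2 * 1 + j.+1 = j + 3)%N; last lia.
rewrite (_ : 2 * 1 + j = j + 2)%N; last lia.
rewrite !exprD; move: ('X) => z; move: (z ^+ j) ((1 + z) ^+ (i + j.+2)) => A B.
ring.
Qed.

Lemma trinomial_odd a b : odd (a + b) -> trinomial a b = 0%N.
Proof. by rewrite /trinomial => ->. Qed.

Lemma trinomial_rec a b :
  trinomial a b = (((a == 0) && (b == 0)) + (if 1 < a then trinomial (a - 2) b else 0)
    + (if (0 < a) && (0 < b) then trinomial a.-1 b.-1 else 0)
    + (if 1 < b then trinomial a (b - 2) else 0))%N.
Proof.
have [oab|eab] := boolP (odd (a + b)).
  rewrite trinomial_odd //; do 3?[case: ifP => [?|_]];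
    rewrite ?trinomial_odd ?addn0 //; lia.
have [N ab] : exists N, (a + b = N.*2)%N by exists (a + b)./2; lia.
case: N ab => [|N] ab.
  have [-> ->] : a = 0%N /\ b = 0%N by lia.
  by rewrite /trinomial /= expr0 !coef1.
have -> : (a == 0%N) && (b == 0%N) = false by lia.
have tE c d : (c + d = N.*2)%N -> trinomial c d =
    (('X ^+ 2 + 'X * 'X%:P + 'X%:P ^+ 2 : {poly {poly nat}}) ^+ N)`_c`_d.
  by move=> cd; rewrite /trinomial cd odd_double doubleK.
rewrite {1}/trinomial (negbTE eab) ab doubleK exprS.
set P := (_ ^+ N) in tE *.
rewrite !mulrDl !coefD -['X * 'X%:P * P]mulrA -['X%:P ^+ 2]rmorphXn /=.
rewrite coefXnM coefXM !coefCM coefXnM add0n.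
congr (_ + _ + _)%N.
- by case: ltnP => h; rewrite ?coef0 // tE //; lia.
- case: a ab eab => [|a] ab eab /=; first by rewrite ?mulr0 ?coef0.
  by rewrite coefXM; case: b ab eab => [|b] ab eab //=; rewrite tE //; lia.
- by case: ltnP => h //; rewrite tE //; lia.
Qed.

(** The bivariate power is homogeneous, so nothing is lost by setting x = 1. *)
Lemma trinomial_coef N b :
  ((1 + 'X + 'X ^+ 2 : {poly nat}) ^+ N)`_b =
  if (b <= N.*2)%N then trinomial (N.*2 - b) b else 0%N.
Proof.
elim: N b => [|N IHN] b.
  by rewrite expr0 coef1 leqn0; case: b => // ; rewrite /trinomial /= expr0 !coef1.
rewrite exprS !mulrDl mul1r !coefD coefXM coefXnM !IHN.
have [h|h] := leqP b N.+1.*2; last first.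
  by do !(rewrite ifF; last lia).
rewrite [RHS]trinomial_rec.
have -> : (N.+1.*2 - b == 0)%N && (b == 0)%N = false by lia.
rewrite add0n; congr (_ + _ + _)%N.
- rewrite (_ : N.+1.*2 - b - 2 = N.*2 - b)%N; last lia.
  by congr (if _ then _ else _); lia.
- case: b h => [|b] h; rewrite ?andbF //=.
  rewrite (_ : (N.+1.*2 - b.+1).-1 = N.*2 - b)%N; last lia.
  by congr (if _ then _ else _); lia.
- case: ltnP => // h'; rewrite ifT; last lia.
  by congr trinomial; lia.
Qed.

(** Write 1 + z + z^2 as z^2 + (1 + z) in the factor with exponent [m] and as
    1 + z (1 + z) in the factor with exponent [n], expand both by the binomial
    theorem and take the coefficient of z^(2 m). *)
Lemma trinomial_crossing m n :
  trinomial (2 * n) (2 * m) =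
  (\sum_(i < m.+1) 'C(m, i) * \sum_(j < n.+1) 'C(n, j) * crossing i j)%N.
Proof.
have -> : trinomial (2 * n) (2 * m) =
    ((1 + 'X + 'X ^+ 2 : {poly nat}) ^+ (m + n))`_(2 * m).
  rewrite trinomial_coef ifT; last lia.
  by congr trinomial; lia.
pose z : {poly nat} := 'X.
have -> : 1 + 'X + 'X ^+ 2 = z ^+ 2 + (1 + z) by rewrite /z; ring.
rewrite exprD {2}(_ : z ^+ 2 + (1 + z) = 1 + z * (1 + z)); last by rewrite /z; ring.
rewrite !exprDn big_distrl coef_sum; apply: eq_bigr => i _ /=.
rewrite big_distrr coef_sum big_distrr; apply: eq_bigr => j _ /=.
rewrite (@crossing_coef m) -1?ltnS // expr1n mul1r mulrnAl mulrnAr !coefMn.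
have -> : z ^+ 2 ^+ (m - i) * (1 + z) ^+ i * (z * (1 + z)) ^+ j =
    (1 + 'X) ^+ (i + j) * 'X^(2 * (m - i) + j).
  rewrite -exprM (exprMn _ z) !exprD /z; move: 'X => x; ring.
by rewrite -mulrnA -mulr_natr natn [RHS]mulnA [RHS]mulnC [in RHS](mulnC 'C(m, i)).
Qed.

(** * T-paths *)

(** Extending by 0 to negative arguments spares the boundary conditions in the
    recurrence. *)
Definition trinomial_int (a b : int) : nat :=
  if (0 <= a) && (0 <= b) then trinomial (absz a) (absz b) else 0%N.

Lemma trinomial_int_out (a b : int) : (a < 0) || (b < 0) -> trinomial_int a b = 0%N.
Proof. by rewrite /trinomial_int; case: ifP => //; lia. Qed.

Lemma trinomial_int_rec (a b : int) :
  trinomial_int a b =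
    (((a == 0) && (b == 0)) + trinomial_int (a - 2) b
     + trinomial_int (a - 1) (b - 1) + trinomial_int a (b - 2))%N.
Proof.
have [|] := boolP ((a < 0) || (b < 0)).
  move=> out; have -> : (a == 0) && (b == 0) = false by lia.
  by rewrite !trinomial_int_out //; lia.
rewrite negb_or -!leNgt; case: a => // a; case: b => // b _.
rewrite {1}/trinomial_int /= trinomial_rec /trinomial_int; congr (_ + _ + _ + _)%N.
- by case: ltnP => h; [rewrite ifT; [congr trinomial|]|rewrite ifF]; lia.
- by case: andP => h; [rewrite ifT; [congr trinomial|]|rewrite ifF]; lia.
- by case: ltnP => h; [rewrite ifT; [congr trinomial|]|rewrite ifF]; lia.
Qed.

Lemma T_stepE (x y x' y' : int) : (((x', y') : vertex) - (x, y) \in T_steps) =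
  [|| (x' == x + 2) && (y' == y), (x' == x + 1) && (y' == y + 1)
    | (x' == x) && (y' == y + 2)].
Proof. rewrite !inE -!pair_eqE /=; lia. Qed.

Lemma card_T_paths (n m : nat) :
  (T_paths (0, - (2 * m)%:Z) ((2 * n)%:Z, 0) #= `I_(trinomial (2 * n) (2 * m)))%card.
Proof.
pose c (u : vertex) := trinomial_int ((2 * n)%:Z - u.1) (- u.2).
have -> : trinomial (2 * n) (2 * m) = c (0, - (2 * m)%:Z).
  by rewrite /c /= subr0 opprK.
apply: (@card_paths _ (fun u => [:: (u.1 + 2, u.2); (u.1 + 1, u.2 + 1); (u.1, u.2 + 2)])
  _ _ _ predT (fun u => (2 * n)%:Z - u.1 - u.2)) => //.
- move=> [x y]; rewrite /= !inE !xpair_eqE; lia.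
- move=> [x y] [x' y']; rewrite T_stepE !inE !xpair_eqE /=; lia.
- move=> [x y] [x' y'] _; rewrite T_stepE /=; lia.
- move=> [x y] _ /= h; rewrite /c trinomial_int_out //=; lia.
move=> [x y] _; rewrite !big_cons big_nil !T_stepE /=.
do 3!(rewrite ifT; last lia).
rewrite {1}/c trinomial_int_rec addn0 -!addnA /c /=.
congr (_ + (_ + (_ + _)))%N; first by rewrite xpair_eqE; lia.
all: by congr trinomial_int; lia.
Qed.

(** * K-paths *)

Section KPaths.
Variables m n : nat.

(** For (x, -h) between the two lines: the sum runs over the point (2 j, -j) where
    the path meets x = -2 y, after which there are binom(n, j) ways to go on. *)
Definition nb_lower (x h : int) : nat :=
  \sum_(j < n.+1) 'C(n, j) * nb_normal (2 * j%:Z - x) (h - j%:Z).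

(** For (x, -2 k) below y = -2 x: the sum runs over the point (i, -2 i) where the
    path meets that line.  The bound [m] on [i] is harmless as [k <= m]. *)
Definition nb_upper (x k : int) : nat :=
  \sum_(i < m.+1) nb_normal (i%:Z - x) (k - i%:Z) * nb_lower i%:Z (2 * i%:Z).

Definition nb_K (u : vertex) : nat :=
  let x := u.1 in let h := - u.2 in
  if 2 * x < h then nb_upper x (h %/ 2)%Z
  else if x < 2 * h then nb_lower x h
  else nb_normal (n%:Z - (x %/ 2)%Z) h.

Lemma nb_lower_line (k : int) : 0 <= k ->
  nb_lower (2 * k) k = nb_normal (n%:Z - k) k.
Proof.
case: k => // k _; have [kn|nk] := leqP k n; last first.
  rewrite [RHS]nb_normal_out; last lia.
  apply: big1 => j _; rewrite nb_normal_out ?muln0 //; have := ltn_ord j; lia.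
rewrite /nb_lower (bigD1 (Ordinal (kn : (k < n.+1)%N))) //= !subrr big1 ?addn0 => [|j jk].
  by rewrite muln1 subzn // nb_normal_nat subnK.
have {}jk : (j : nat) != k := jk.
by rewrite nb_normal_out ?muln0 //; lia.
Qed.

Lemma nb_lower_rec (x h : int) : x < 2 * h ->
  nb_lower x h = (nb_lower (x + 1) h + nb_lower x (h - 1))%N.
Proof.
move=> xh; rewrite /nb_lower -big_split /=; apply: eq_bigr => j _.
rewrite nb_normal_rec -mulnDr; congr (_ * _)%N.
have -> : (2 * j%:Z - x == 0) && (h - j%:Z == 0) = false by lia.
by rewrite add0n; congr (nb_normal _ _ + nb_normal _ _)%N; lia.
Qed.

(** A step up from (2 h - 1, -h) would jump over the line x = -2 y, which the
    definition of K-paths forbids.  Dropping that step from the recurrence is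
    legitimate because no normal path leads from its endpoint to the line. *)
Lemma nb_lower_dead (h : int) : nb_lower (2 * h - 1) (h - 1) = 0%N.
Proof. by rewrite /nb_lower big1 // => j _; rewrite nb_normal_out ?muln0 //; lia. Qed.

Lemma nb_upper_line (k : int) : 0 <= k <= m%:Z ->
  nb_upper k k = nb_lower k (2 * k).
Proof.
case: k => // k km; have {}km : (k < m.+1)%N by lia.
rewrite /nb_upper (bigD1 (Ordinal km)) //= !subrr big1 ?addn0 => [|i ik].
  by rewrite mul1n.
have {}ik : (i : nat) != k := ik.
by rewrite nb_normal_out ?mul0n //; lia.
Qed.

Lemma nb_upper_rec (x k : int) : x < k ->
  nb_upper x k = (nb_upper (x + 1) k + nb_upper x (k - 1))%N.
Proof.
move=> xk; rewrite /nb_upper -big_split /=; apply: eq_bigr => i _.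
rewrite nb_normal_rec -mulnDl; congr (_ * _)%N.
have -> : (i%:Z - x == 0) && (k - i%:Z == 0) = false by lia.
by rewrite add0n; congr (nb_normal _ _ + nb_normal _ _)%N; lia.
Qed.

(** The next three lemmas give [nb_K] on closed regions: the formulas for two
    neighbouring regions agree on the line between them, so that the first-step
    recurrence can be checked without asking on which side of the line a step
    ends. *)
Lemma nb_K_right (k h : int) : 0 <= k -> h <= k ->
  nb_K (2 * k, - h) = nb_normal (n%:Z - k) h.
Proof.
move=> k0 hk; rewrite /nb_K /= opprK !ifF; try lia.
by congr nb_normal; lia.
Qed.

Lemma nb_K_lower (x h : int) : 0 <= x -> h <= 2 * x -> x <= 2 * h ->
  nb_K (x, - h) = nb_lower x h.
Proof.
move=> x0 hx xh; have [xE|xh'] := eqVneq x (2 * h).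
  by rewrite xE nb_K_right ?nb_lower_line //; lia.
by rewrite /nb_K /= opprK ifF ?ifT //; lia.
Qed.

Lemma nb_K_upper (x k : int) : 0 <= x -> x <= k -> k <= m%:Z ->
  nb_K (x, - (2 * k)) = nb_upper x k.
Proof.
move=> x0 xk km; have [xE|xk'] := eqVneq x k.
  by rewrite xE nb_upper_line ?nb_K_lower //; lia.
by rewrite /nb_K /= opprK ifT; [congr nb_upper|]; lia.
Qed.

Lemma K_stepE (x y x' y' : int) : K_step (x, y) (x', y') =
  [|| [&& y < - 2 * x, y' <= - 2 * x' &
          (x' == x + 1) && (y' == y) || (x' == x) && (y' == y + 2)],
      [&& - 2 * x <= y, x < - 2 * y, x' <= - 2 * y' &
          (x' == x + 1) && (y' == y) || (x' == x) && (y' == y + 1)]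
    | [&& - 2 * x <= y, - 2 * y <= x &
          (x' == x + 2) && (y' == y) || (x' == x) && (y' == y + 1)]].
Proof.
rewrite /K_step /= !inE -!pair_eqE /=.
by case: ifP => h1; [|case: ifP => h2]; lia.
Qed.

(** Below y = -2 x the ordinate stays even, and beyond x = -2 y the abscissa is
    even: steps of length 2 are taken there, and the forbidden jumps make the paths
    enter the last region at a point of the line x = -2 y. *)
Definition K_inv (u : vertex) : bool :=
  [&& 0 <= u.1, - u.2 <= 2 * m%:Z, u.2 <= u.1,
      (2 * u.1 < - u.2) ==> (2 %| u.2)%Z & (- 2 * u.2 <= u.1) ==> (2 %| u.1)%Z].

(** The condition to stay below the diagonal becomes part of the step relation,
    so that K-paths are the paths of a single relation. *)
Definition K_step_below (u w : vertex) : bool := K_step u w && (w.2 <= w.1).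

Lemma path_K_step_below (u : vertex) (p : seq vertex) : path K_step_below u p =
  all (fun w : vertex => w.2 <= w.1) p && path K_step u p.
Proof.
elim: p u => //= w p IHp u.
by rewrite IHp /K_step_below [K_step u w && (w.2 <= w.1)]andbC andbACA.
Qed.

Lemma nb_K_rec u : K_inv u ->
  nb_K u = ((u == ((2 * n)%:Z, 0))%R +
    \sum_(w <- [:: (u.1 + 1, u.2)%R; (u.1, u.2 + 1)%R; (u.1 + 2, u.2)%R; (u.1, u.2 + 2)%R]
      | K_step_below u w) nb_K w)%N.
Proof.
case: u => x y; rewrite /K_inv /= => /and5P[x0 ym yx /implyP h1 /implyP h2].
rewrite big_mkcond !big_cons big_nil /K_step_below !K_stepE /= xpair_eqE.
have [r1|r1] := boolP (y < - 2 * x).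
  have [k yE] : exists k : int, y = - (2 * k) by exists (- (y %/ 2)%Z); lia.
  subst y.
  rewrite ifT; last lia. rewrite ifF; last lia. rewrite ifF; last lia.
  rewrite ifT; last lia.
  rewrite (_ : - (2 * k) + 2 = - (2 * (k - 1))); last lia.
  rewrite !nb_K_upper; try lia.
  rewrite nb_upper_rec; lia.
have [r2|r2] := boolP (x < - 2 * y).
  have [h yE] : exists h : int, y = - h by exists (- y); lia.
  subst y.
  rewrite ifT; last lia.
  rewrite nb_K_lower; try lia. rewrite nb_K_lower; try lia.
  rewrite nb_lower_rec; last lia.
  case: ifP => dn.
    rewrite ifF; last lia. rewrite ifF; last lia.
    rewrite (_ : - h + 1 = - (h - 1)); last lia.
    rewrite nb_K_lower; lia.
  rewrite ifF; last lia. rewrite ifF; last lia.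
  rewrite (_ : x = 2 * h - 1); last lia.
  rewrite nb_lower_dead; lia.
have [k xE] : exists k : int, x = 2 * k by exists (x %/ 2)%Z; lia.
have [h yE] : exists h : int, y = - h by exists (- y); lia.
subst x y.
rewrite ifF; last lia.
rewrite [in RHS](_ : 2 * k + 2 = 2 * (k + 1)); last lia.
rewrite [in RHS](_ : - h + 1 = - (h - 1)); last lia.
rewrite [X in (_ + (0 + (_ + (X + _))))%N]ifT; last lia.
rewrite [X in (_ + (0 + (_ + (_ + (X + _)))))%N]ifF; last lia.
rewrite !nb_K_right; try lia.
rewrite nb_normal_rec; case: ifP => dn; last rewrite (@nb_normal_out _ (h - 1)); try lia.
- rewrite (_ : n%:Z - (k + 1) = n%:Z - k - 1); lia.
- rewrite (_ : n%:Z - (k + 1) = n%:Z - k - 1); lia.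
Qed.

Lemma card_K_paths :
  (K_paths (0, - (2 * m)%:Z) ((2 * n)%:Z, 0)
    #= `I_(nb_K (0%R, (- (2 * m)%:Z)%R)))%card.
Proof.
set u0 : vertex := (0%R, (- _)%R).
have -> : K_paths u0 ((2 * n)%:Z, 0) =
    [set p | sorted K_step_below p /\
             joins u0 ((2 * n)%:Z, 0) p]%classic.
  apply/seteqP; split=> -[|x p] [+ jp] //=; have /andP[/eqP[xu] _] := jp;
    rewrite {}xu in jp *.
  - move=> /andP[/= /andP[_ ap] sp]; split=> //.
    by apply: (etrans (path_K_step_below _ _)); rewrite ap.
  - move=> /(etrans (esym (path_K_step_below _ _)))/andP[ap sp]; split=> //.
    by apply/andP; rewrite /= sp ap /u0 /=; split=> //; lia.
apply: (@card_paths _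
  (fun u => [:: (u.1 + 1, u.2); (u.1, u.2 + 1); (u.1 + 2, u.2); (u.1, u.2 + 2)]) _ _ _ K_inv (fun u => (2 * n)%:Z - u.1 - u.2)).
- move=> [x y]; rewrite /= !inE !xpair_eqE; lia.
- move=> [x y] [x' y']; rewrite /K_step_below K_stepE !inE !xpair_eqE /=; lia.
- move=> [x y] [x' y']; rewrite /K_step_below K_stepE /K_inv /=; lia.
- move=> [x y]; rewrite /K_inv /nb_K /= => iu mu.
  case: ifP => h1; first lia.
  case: ifP => h2; last by rewrite nb_normal_out //; lia.
  rewrite /nb_lower big1 // => j _; rewrite nb_normal_out ?muln0 //.
  have := ltn_ord j; lia.
- exact: nb_K_rec.
by rewrite /K_inv /u0 /=; lia.
Qed.

Lemma nb_K_start :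
  nb_K (0, - (2 * m)%:Z) =
  (\sum_(i < m.+1) 'C(m, i) * \sum_(j < n.+1) 'C(n, j) * crossing i j)%N.
Proof.
rewrite (_ : (2 * m)%:Z = 2 * m%:Z); last lia.
rewrite nb_K_upper //; apply: eq_bigr => i _; congr (_ * _)%N.
have im := ltn_ord i.
by rewrite subr0 subzn // nb_normal_nat subnKC // bin_sub.
Qed.
End KPaths.

(** * The Hankel determinant *)

(** The finite difference of a polynomial has smaller degree, because
    (X + 1)^i - X^i does. *)
Lemma size_comp_addX1_sub (R : comNzRingType) (p : {poly R}) (l : nat) :
  (size p <= l.+1)%N -> (size (p - (p \Po ('X + 1)))%R <= l)%N.
Proof.
move=> pl; rewrite -[X in X - _]comp_polyXr !comp_polyE -sumrB.
apply: (big_ind (fun q : {poly R} => size q <= l)%N); rewrite ?size_poly0 //.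
  by move=> q r ql rl; apply: leq_trans (size_polyD _ _) _; rewrite geq_max ql.
move=> i _; rewrite -scalerBr; apply: leq_trans (size_scale_leq _ _) _.
rewrite subrXX opprD addNKr mulN1r size_polyN.
apply: (big_ind (fun q : {poly R} => size q <= l)%N); rewrite ?size_poly0 //.
  by move=> q r ql rl; apply: leq_trans (size_polyD _ _) _; rewrite geq_max ql.
move=> k _; apply: leq_trans (size_polyMleq _ _) _.
rewrite size_polyXn.
have : (size (('X + 1 : {poly R}) ^+ k) <= k.+1)%N.
  by have := size_poly_exp_leq ('X + 1%:P : {poly R}) k; rewrite size_XaddC mul1n.
move: (size (('X + 1 : {poly R}) ^+ k)) => d; have := ltn_ord k; have := ltn_ord i; lia.
Qed.

(** An [l]-th finite difference kills polynomials of degree less than [l]. *)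
Lemma alt_binomial_sum (R : comNzRingType) (p : {poly R}) (l : nat) : (size p <= l)%N ->
  \sum_(j < l.+1) (-1) ^+ j * 'C(l, j)%:R * p.[j%:R] = 0.
Proof.
elim: l p => [|l IHl] p pl.
  move: pl; rewrite leqn0 size_poly_eq0 => /eqP->.
  by rewrite big1 // => j _; rewrite horner0 mulr0.
rewrite -[RHS](IHl (p - (p \Po ('X + 1)))) ?size_comp_addX1_sub //.
pose f j := (-1) ^+ j * 'C(l, j)%:R * p.[j%:R].
have f0 : \sum_(j < l.+2) f j = \sum_(j < l.+1) f j.
  by rewrite big_ord_recr /= /f bin_small // mulr0 mul0r addr0.
transitivity (\sum_(j < l.+1) f j
   - \sum_(j < l.+1) (-1) ^+ j * 'C(l, j)%:R * p.[j.+1%:R]); last first.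
  rewrite -sumrB; apply: eq_bigr => j _.
  by rewrite hornerD hornerN horner_comp hornerD hornerX -polyC1 hornerC natr1 mulrBr.
rewrite -f0 big_ord_recl [X in _ = X - _]big_ord_recl /= /f !bin0 -addrA; congr (_ + _).
rewrite -sumrB; apply: eq_bigr => j _.
rewrite /bump /= !add1n binS natrD exprS; ring.
Qed.

(** The coefficients of t^k in (1 + t)^2 / ((1 + t)^3 - x t), the sum over i of
    x^i t^i (1 + t)^(- 3 i - 1).  The binomial coefficient vanishes for i > k. *)
Definition hankel_basis (k : nat) : {poly rat} :=
  \poly_(i < k.+1) ((-1) ^+ (k + i) * 'C(k + 2 * i, 3 * i)%:R).

Lemma coef_hankel_basis k i :
  (hankel_basis k)`_i = (-1) ^+ (k + i) * 'C(k + 2 * i, 3 * i)%:R.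
Proof.
rewrite coef_poly; case: ltnP => // ki.
by rewrite bin_small ?mulr0 //; lia.
Qed.

(** The linear functional with moments a_i, the one that represents the Hankel
    matrix as a Gram matrix. *)
Definition moment (p : {poly rat}) : rat := \sum_(i < size p) p`_i * acoef i.

Lemma momentE N (p : {poly rat}) : (size p <= N)%N ->
  moment p = \sum_(i < N) p`_i * acoef i.
Proof.
move=> pN; rewrite /moment (big_ord_widen N (fun i => p`_i * acoef i) pN) big_mkcond /=.
by apply: eq_bigr => i _; case: ltnP => // h; rewrite nth_default ?mul0r.
Qed.

Lemma moment_is_scalar : scalar moment.
Proof.
move=> a p q; pose N := maxn (size p) (size q).
rewrite !(@momentE N) ?leq_maxl ?leq_maxr //; last first.
  rewrite (leq_trans (size_polyD _ _)) // geq_max leq_maxr andbT.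
  by rewrite (leq_trans (size_scale_leq _ _)) // leq_maxl.
rewrite mulr_sumr -big_split; apply: eq_bigr => i _.
by rewrite coefD coefZ mulrDl mulrA.
Qed.

HB.instance Definition _ :=
  GRing.isLinear.Build rat {poly rat} rat *%R moment moment_is_scalar.

Lemma moment_Xn i : moment 'X^i = acoef i.
Proof.
rewrite /moment size_polyXn big_ord_recr big1 /= ?add0r => [|j _].
  by rewrite coefXn eqxx mul1r.
by rewrite coefXn ltn_eqF ?mul0r.
Qed.

Lemma moment_mul N (p q : {poly rat}) : (size p <= N)%N -> (size q <= N)%N ->
  moment (p * q) = \sum_(i < N) \sum_(j < N) p`_i * q`_j * acoef (i + j).
Proof.
move=> pN qN.
have sumX (r : {poly rat}) : (size r <= N)%N -> r = \sum_(i < N) r`_i *: 'X^i.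
  move=> rN; rewrite -poly_def; apply/polyP => i; rewrite coef_poly.
  by case: ltnP => // /(leq_trans rN)/leq_sizeP->.
rewrite {1}(sumX p) // {1}(sumX q) // mulr_suml linear_sum; apply: eq_bigr => i _.
rewrite mulr_sumr linear_sum; apply: eq_bigr => j _.
by rewrite -scalerAl -scalerAr scalerA -exprD linearZ /= moment_Xn.
Qed.

Lemma fact_rising l a : ((a.+1)`! * \prod_(r < l) (a + r.+2) = (a + l.+1)`!)%N.
Proof.
elim: l => [|l IHl]; first by rewrite big_ord0 muln1 addn1.
by rewrite big_ord_recr mulnA IHl [in RHS]addnS factS mulnC addnS.
Qed.

(** As a function of [i], a_i times the coefficient of x^i in q_(l+1) is, up to sign
    and a constant factor, binom(l + 1, i) times a polynomial in [i] of degree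
    [l]. *)
Lemma bin_ternary l i : (i <= l.+1)%N ->
  ('C(l.+1 + 2 * i, 3 * i) * 'C(3 * i, i) * (l.+1)`! =
   'C(l.+1, i) * (\prod_(r < l) (2 * i + r.+2)) * (2 * i + 1))%N.
Proof.
move=> il; apply/eqP.
have pos : (0 < i`! * (2 * i)`! * (l.+1 - i)`!)%N by rewrite !muln_gt0 !fact_gt0.
rewrite -(eqn_pmul2r pos); apply/eqP.
have e1 : ('C(l.+1 + 2 * i, 3 * i) * ((3 * i)`! * (l.+1 - i)`!) = (l.+1 + 2 * i)`!)%N.
  by rewrite -(@bin_fact (l.+1 + 2 * i) (3 * i)); [congr (_ * (_ * _`!))%N|]; lia.
have e2 : ('C(3 * i, i) * (i`! * (2 * i)`!) = (3 * i)`!)%N.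
  by rewrite -(@bin_fact (3 * i) i); [congr (_ * (_ * _`!))%N|]; lia.
have e3 := bin_fact il.
have e4 := fact_rising l (2 * i).
transitivity ((l.+1 + 2 * i)`! * (l.+1)`!)%N.
  by rewrite -e1 -e2; ring.
by rewrite addnC -e4 -e3 factS; ring.
Qed.

(** Orthogonality to the constants: by [bin_ternary] the left side is a finite
    difference of order greater than the degree. *)
Lemma moment_hankel_basis l : moment (hankel_basis l) = (l == 0%N)%:R.
Proof.
rewrite (momentE (size_poly _ _)).
case: l => [|l].
  by rewrite big_ord1 coef_hankel_basis /acoef /=.
pose p : {poly rat} := \prod_(r < l) (2 *: 'X + (r.+2)%:R%:P).
have sp : (size p <= l.+1)%N.
  rewrite /p; elim: (l) => [|k IHk]; first by rewrite big_ord0 size_poly1.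
  rewrite big_ord_recr /=; apply: leq_trans (size_polyMleq _ _) _.
  have : (size (2 *: 'X + (k.+2)%:R%:P : {poly rat})%R <= 2)%N.
    rewrite (leq_trans (size_polyD _ _)) // geq_max.
    rewrite (leq_trans (size_scale_leq _ _)) ?size_polyX //.
    by rewrite (leq_trans (size_polyC_leq1 _)).
  by move: IHk; set a := size _; set b := size _; lia.
have pE i : p.[i%:R] = (\prod_(r < l) (2 * i + r.+2))%N%:R.
  rewrite /p horner_prod natr_prod; apply: eq_bigr => r _.
  by rewrite hornerD hornerZ hornerX hornerC natrD natrM.
transitivity ((-1) ^+ l.+1 / (l.+1)`!%:R *
    (\sum_(i < l.+2) (-1) ^+ i * 'C(l.+1, i)%:R * p.[i%:R])).
  rewrite mulr_sumr; apply: eq_bigr => i _.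
  rewrite coef_hankel_basis /acoef pE exprD.
  have := @bin_ternary l i (ltn_ord i); have := fact_gt0 l.+1.
  move: (l.+1)`! (\prod_(r < l) _)%N => F p_i F0 /(congr1 (fun k => k%:R : rat)).
  rewrite !natrM => e.
  have f0 : F%:R != 0 :> rat by rewrite pnatr_eq0 -lt0n.
  have g0 : (2 * i + 1)%:R != 0 :> rat by rewrite pnatr_eq0 addn1.
  rewrite -[(-1) ^+ i * _ * _]mulrA.
  have -> : 'C(l.+1, i)%:R * p_i%:R =
      'C(l.+1 + 2 * i, 3 * i)%:R * 'C(3 * i, i)%:R * F%:R / (2 * i + 1)%:R :> rat.
    by rewrite e mulfK.
  move: ((2 * i + 1)%:R) g0 => g g0; field; exact/andP.
by rewrite alt_binomial_sum ?mulr0.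
Qed.

(** Multiplication by x in the basis q_k.  The first two cases are the general one
    with the convention s(-1) = - s(0) and s(-2) = s(0), which comes from the
    numerator (1 + t)^2 of the generating function. *)
Definition shift3 (V : nmodType) (s : nat -> V) (n : nat) : V :=
  match n with
  | 0 => s 1%N + s 0%N
  | 1 => s 2 + s 1%N *+ 3 + s 0%N *+ 2
  | k.+2 => s k.+3 + s k.+2 *+ 3 + s k.+1 *+ 3 + s k
  end.

(** Away from the boundary, the coefficient identity is Pascal's rule applied three
    times. *)
Lemma mulX_hankel_basis n : 'X * hankel_basis n = shift3 hankel_basis n.
Proof.
apply/polyP => i; rewrite coefXM.
case: n => [|[|n]] /=; rewrite !(coefD, coefMn) !coef_hankel_basis.
- case: i => [|[|i]]; [exact/eqP | exact/eqP |].
  by rewrite /= !bin_small ?mulr0 ?addr0 //; lia.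
- case: i => [|[|[|i]]]; [exact/eqP | exact/eqP | exact/eqP |].
  by rewrite /= !bin_small ?mulr0 ?mul0rn ?addr0 //; lia.
case: i => [|i] /=.
  rewrite muln0 !addn0 !bin0 !exprS; ring.
pose N := (n + 2 * i).+2.
rewrite (_ : n.+2 + 2 * i = N)%N; last lia.
rewrite (_ : n.+3 + 2 * i.+1 = N.+3)%N; last lia.
rewrite (_ : n.+2 + 2 * i.+1 = N.+2)%N; last lia.
rewrite (_ : n.+1 + 2 * i.+1 = N.+1)%N; last lia.
rewrite (_ : n + 2 * i.+1 = N)%N; last lia.
rewrite (_ : 3 * i.+1 = (3 * i).+3)%N; last lia.
rewrite !binS !natrD !addSn !addnS !exprS; ring.
Qed.

Lemma crossing0 l : crossing 0 l = (l == 0%N).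
Proof.
by case: l => [|l] //; rewrite /crossing nb_normal_out //; lia.
Qed.

Lemma crossingE k l :
  crossing k l = if (k <= 2 * l)%N && (l <= 2 * k)%N then 'C(k + l, 2 * k - l) else 0%N.
Proof.
rewrite /crossing /nb_normal; case: ifP => h.
  by rewrite ifT; [congr ('C(_, _))|]; lia.
by rewrite ifF //; lia.
Qed.

Lemma eq_shift3 (V : nmodType) (s t : nat -> V) n : s =1 t -> shift3 s n = shift3 t n.
Proof. by move=> st; case: n => [|[|n]] /=; rewrite !st. Qed.

(** The analogue for G of the identity moment ((x q_k) q_l) = moment (q_k (x q_l)).
    [crossing_shift] covers k, l >= 2; in the other cases almost all terms
    vanish. *)
Lemma crossing_shift3 k l :
  shift3 (crossing^~ l) k = shift3 (crossing k) l.
Proof.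
wlog kl : k l / (k <= l)%N.
  move=> H; have [|/ltnW/H lk] := leqP k l; first exact: H.
  rewrite (@eq_shift3 _ _ (crossing l)) => [|i]; last exact: crossingC.
  by rewrite -lk; apply: eq_shift3 => i; exact: crossingC.
case: k kl => [|[|k]].
- by case: l => [|[|[|l]]] _; rewrite /= !crossingE.
- by case: l => [|[|[|[|[|l]]]]] // _; rewrite /= !crossingE.
case: l => [|[|l]] // _ /=.
have := crossing_shift k l; rewrite !mulrS !mulr0n; lia.
Qed.

Lemma hankel_basis0 : hankel_basis 0 = 1.
Proof.
by apply/polyP => -[|i]; rewrite coef_hankel_basis coef1 //= bin_small ?mulr0 //; lia.
Qed.

Lemma moment_shift3 p n :
  moment (shift3 hankel_basis n * p) = shift3 (fun k => moment (hankel_basis k * p)) n.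
Proof. by case: n => [|[|n]] /=; rewrite !mulrDl ?mulrnAl !linearD /= ?linearMn. Qed.

Lemma natr_shift3 (R : pzSemiRingType) (s : nat -> nat) n :
  (shift3 s n)%:R = shift3 (fun k => (s k)%:R : R) n.
Proof. by case: n => [|[|n]] /=; rewrite ?mulrS ?mulr0n ?natrD. Qed.

(** [shift3 s n] is [s n.+1] plus a combination of earlier terms. *)
Lemma shift3_inj (V : zmodType) (s t : nat -> V) n :
  (forall k, (k <= n)%N -> s k = t k) -> shift3 s n = shift3 t n -> s n.+1 = t n.+1.
Proof.
case: n => [|[|n]] st /=.
- by rewrite (st 0%N) // => /addIr.
- by rewrite (st 0%N) // (st 1%N) // => /addIr/addIr.
- rewrite (st n.+2 (leqnn _)) (st n.+1 (leqnSn _)) (st n (leqW (leqnSn _))).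
  by move=> /addIr/addIr/addIr.
Qed.

(** Induction on [k]: moving x from q_k to q_l computes row k + 1 from the rows up
    to k by the same rule as for G. *)
Lemma moment_crossing k l :
  moment (hankel_basis k * hankel_basis l) = (crossing k l)%:R.
Proof.
elim/ltn_ind: k l => -[|k] IHk l.
  by rewrite hankel_basis0 mul1r moment_hankel_basis crossing0; case: l.
apply: (@shift3_inj _ (fun k => moment (hankel_basis k * hankel_basis l))
  (fun k => (crossing k l)%:R)) => [j jk|]; first exact: IHk.
rewrite -moment_shift3 -natr_shift3 crossing_shift3 natr_shift3.
rewrite -mulX_hankel_basis -mulrA mulrCA mulX_hankel_basis mulrC moment_shift3.
by apply: eq_shift3 => j; rewrite mulrC IHk.
Qed.

Lemma det_unitriangular_congruence (R : comPzRingType) n (P A : 'M[R]_n) :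
  (forall i j : 'I_n, (i < j)%N -> P i j = 0) -> (forall i, P i i = 1) ->
  \det (P *m A *m P^T) = \det A.
Proof.
move=> P0 P1; have detP : \det P = 1.
  rewrite det_trig; first by rewrite big1.
  by apply/is_trig_mxP.
by rewrite !det_mulmx det_tr detP mul1r mulr1.
Qed.

Lemma U_crossing n : U n = \det (\matrix_(i < n, j < n) (crossing i j)%:R).
Proof.
pose P : 'M[rat]_n := \matrix_(i, j) (hankel_basis i)`_j.
rewrite /U -(@det_unitriangular_congruence _ _ P) => [|i j ij|i]; rewrite ?mxE.
- congr (\det _); apply/matrixP => i j; rewrite !mxE -moment_crossing.
  have sz (k : 'I_n) : (size (hankel_basis k) <= n)%N.
    exact: leq_trans (size_poly _ _) _.
  rewrite (moment_mul (sz i) (sz j)) exchange_big /=; apply: eq_bigr => l _.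
  rewrite !mxE mulr_suml; apply: eq_bigr => k _.
  by rewrite !mxE mulrAC.
- by rewrite coef_poly ltnNge ij.
- rewrite coef_hankel_basis addnn -signr_odd odd_double expr0 mul1r.
  by rewrite -mulSn binn.
Qed.

Lemma det_crossing_trinomial n :
  \det (\matrix_(i < n, j < n) (crossing i j)%:R) =
  \det (\matrix_(i < n, j < n) (trinomial (2 * i) (2 * j))%:R) :> rat.
Proof.
pose P : 'M[rat]_n := \matrix_(i, j) ('C(i, j))%:R.
have widen (i : 'I_n) (f : nat -> nat) :
    (\sum_(k < i.+1) 'C(i, k) * f k = \sum_(k < n) 'C(i, k) * f k)%N.
  rewrite (big_ord_widen n (fun k => 'C(i, k) * f k)%N) // big_mkcond /=.
  by apply: eq_bigr => k _; case: ltnP => // ik; rewrite bin_small.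
rewrite -(@det_unitriangular_congruence _ _ P) => [|i j ij|i]; last first.
- by rewrite mxE binn.
- by rewrite mxE bin_small.
congr (\det _); apply/matrixP => i j; rewrite !mxE trinomial_crossing.
rewrite (widen j (fun k => \sum_(l < i.+1) 'C(i, l) * crossing k l)%N) natr_sum.
apply: eq_bigr => l _; rewrite !mxE (widen i (crossing l)) natrM natr_sum mulrC; congr (_ * _).
by apply: eq_bigr => k _; rewrite !mxE natrM crossingC.
Qed.

Theorem theorem7p3 :
  (forall m n : nat,
     let u : vertex := (0, - (2 * m)%:Z) in
     let v : vertex := ((2 * n)%:Z, 0) in
     (K_paths u v #= T_paths u v)%card /\
     (T_paths u v #= `I_(trinomial (2 * n) (2 * m)))%card) /\
  (forall n : nat,
     U n = \det (\matrix_(i < n, j < n) (trinomial (2 * i) (2 * j))%:R)).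
Proof.
split=> [m n u v | n]; last by rewrite U_crossing det_crossing_trinomial.
have Tcard := card_T_paths n m; split=> //.
apply: card_eq_trans (card_esym Tcard).
rewrite trinomial_crossing -nb_K_start; exact: card_K_paths.
Qed.
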